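(* Let $\alpha\in(0,1)$ and let $(X_1,Y_1),\dots,(X_n,Y_n),(X_{n+1},Y_{n+1})$ be exchangeable random pairs in $\mathcal{X}\times\mathbb{R}$. Split the indices into a training set $\{1,\dots,n_0\}$ and a calibration set $\{n_0+1,\dots,n\}$ with $n_1=n-n_0\ge 1$. Suppose a family of prediction bands $\{[\hat q_{\mathrm{lo}}(x,t),\hat q_{\mathrm{hi}}(x,t)]\}_{t\in\mathcal{T}}$ is constructed by either of the two methods below (UACQR-S or UACQR-P) and define $$\hat t=\inf\Big\{t\in\mathcal{T}:\ \sum_{i=n_0+1}^{n}\mathbf{1}\{\hat q_{\mathrm{lo}}(X_i,t)\le Y_i\le \hat q_{\mathrm{hi}}(X_i,t)\}\ \ge (1-\alpha)(n_1+1)\Big\},$$ and $\hat C_n(X_{n+1})=[\hat q_{\mathrm{lo}}(X_{n+1},\hat t),\hat q_{\mathrm{hi}}(X_{n+1},\hat t)]$ (with $\hat C_n(X_{n+1})=\mathbb{R}$ if the set over which the infimum is taken is empty). UACQR-S: $\mathcal{T}=\mathbb{R}$ and $$\hat q_{\mathrm{lo}}(x,t)=\hat q_{Y\mid X}(x,\alpha_{\mathrm{lo}})-t\,\hat g_{\mathrm{lo}}(x),\qquad \hat q_{\mathrm{hi}}(x,t)=\hat q_{Y\mid X}(x,\alpha_{\mathrm{hi}})+t\,\hat g_{\mathrm{hi}}(x),$$ where $\hat q_{Y\mid X}(\cdot,\alpha_{\mathrm{lo}}),\hat q_{Y\mid X}(\cdot,\alpha_{\mathrm{hi}}):\mathcal{X}\to\mathbb{R}$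 are any functions and $\hat g_{\mathrm{lo}},\hat g_{\mathrm{hi}}:\mathcal{X}\to(0,\infty)$ are any strictly positive functions, all fitted using only the training data $\{(X_i,Y_i)\}_{i\le n_0}$ (and possibly independent auxiliary randomness). UACQR-P: given functions $\hat q^b_{Y\mid X}(\cdot,a):\mathcal{X}\to\mathbb{R}$ for $b=1,\dots,B$ and $a\in\{\alpha_{\mathrm{lo}},\alpha_{\mathrm{hi}}\}$, fitted using only the training data (and possibly independent auxiliary randomness), let $\hat q^{(1)}_{Y\mid X}(x,a)\le\dots\le\hat q^{(B)}_{Y\mid X}(x,a)$ be their order statistics at each $x$, set $\hat q^{(0)}_{Y\mid X}(x,a)=-\infty$, $\hat q^{(B+1)}_{Y\mid X}(x,a)=+\infty$, take $\mathcal{T}=\{0,1,\dots,B+1\}$ and $$\hat q_{\mathrm{lo}}(x,t)=\hat q^{(B+1-t)}_{Y\mid X}(x,\alpha_{\mathrm{lo}}),\qquad \hat q_{\mathrm{hi}}(x,t)=\hat q^{(t)}_{Y\mid X}(x,\alpha_{\mathrm{hi}}).$$ Then in both cases $\mathbb{P}\{Y_{n+1}\in\hat C_n(X_{n+1})\}\ge 1-\alpha$.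
   Context: $\alpha_{\mathrm{lo}},\alpha_{\mathrm{hi}}\in(0,1)$ are fixed target quantile levels (e.g. $\alpha/2$ and $1-\alpha/2$); the fitted functions are interpreted as estimates of conditional quantiles of $Y$ given $X$ (and $\hat g$ as estimates of their standard deviation), but no accuracy property is assumed. An interval $[a,b]$ with $a>b$ is empty, and an interval with endpoints $-\infty,+\infty$ is $\mathbb{R}$. Probability is over the joint draw of all $n+1$ data points and any auxiliary randomness. *)

(* Defs.v *)
From HB Require Import structures.
From mathcomp Require Import all_boot all_order all_algebra all_fingroup.
From mathcomp Require Import all_classical all_reals all_analysis.
Unset Printing Implicit Defensive.
Import Order.TTheory GRing.Theory Num.Theory.
Local Open Scope classical_set_scope.
Local Open Scope ring_scope.

Section conformal_defs.
Context {R : realType}.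

Definition permute_tuple {m : nat} {T : Type} (s : 'S_m) (t : m.-tuple T)
  : m.-tuple T := [tuple tnth t (s i) | i < m].

Definition exchangeable {d dT : measure_display} {Omega : measurableType d}
  {T : measurableType dT} {m : nat} (P : probability Omega R)
  (Dt : Omega -> m.-tuple T) : Prop :=
  forall (s : 'S_m) (A : set (m.-tuple T)), measurable A ->
    P ((fun w => permute_tuple s (Dt w)) @^-1` A) = P (Dt @^-1` A).

Definition independent_rv {d dU dV : measure_display} {Omega : measurableType d}
  {U : measurableType dU} {V : measurableType dV} (P : probability Omega R)
  (u : Omega -> U) (v : Omega -> V) : Prop :=
  forall (A : set U) (B : set V), measurable A -> measurable B ->
    P (u @^-1` A `&` v @^-1` B) = (P (u @^-1` A) * P (v @^-1` B))%E.

(* A fitting procedure f maps (the full data tuple, the auxiliary randomness)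
   to a function X -> R.  It is "fitted using only the training data
   {(X_i,Y_i)}_{i <= n0} (and auxiliary randomness)": it depends only on the
   first n0 coordinates of the data tuple; and it is jointly measurable. *)
Definition fitted_on_training {dX dU : measure_display} {X : measurableType dX}
  {U : measurableType dU} {m : nat} (n0 : nat)
  (f : m.-tuple (X * R) -> U -> X -> R) : Prop :=
  (forall t t' : m.-tuple (X * R),
      (forall i : 'I_m, (i < n0)%N -> tnth t i = tnth t' i) -> f t = f t')
  /\ measurable_fun [set: (m.-tuple (X * R) * U) * X]
       (fun p => f p.1.1 p.1.2 p.2).

(* Indexing (0-based): the data tuple d has n+1 entries, indices 0..n.
   training: i < n0 ; calibration: n0 <= i < n  (n1 = n - n0 points);
   test point: index n (ord_max). *)

Context {dX : measure_display} {X : measurableType dX}.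

Definition calib_count (n0 : nat) {n : nat} (cov : X * R -> bool)
  (d : n.+1.-tuple (X * R)) : nat :=
  (\sum_(i < n.+1 | (n0 <= i < n)%N) cov (tnth d i))%N.

Definition inbandS (ql qh gl gh : X -> R) (t : R) (z : X * R) : bool :=
  (ql z.1 - t * gl z.1 <= z.2) && (z.2 <= qh z.1 + t * gh z.1).

(* Y_{n+1} in C_n(X_{n+1}) for UACQR-S; T = R, hat t = inf of the feasible
   set, C_n = R if the feasible set is empty. *)
Definition coveredS (alpha : R) (n0 : nat) {n : nat} (ql qh gl gh : X -> R)
  (d : n.+1.-tuple (X * R)) : Prop :=
  let feas := [set t : R | (1 - alpha) * ((n - n0).+1)%:R
                  <= (calib_count n0 (inbandS ql qh gl gh t) d)%:R] in
  feas = set0 \/ inbandS ql qh gl gh (inf feas) (tnth d ord_max).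

(* k-th order statistic (1-based) of the values s, with the conventions
   k = 0 |-> -oo and k = size s + 1 |-> +oo. *)
Definition order_stat (s : seq R) (k : nat) : \bar R :=
  if k == 0%N then -oo%E
  else if (k <= size s)%N then (nth 0 (sort <=%R s) k.-1)%:E else +oo%E.

Definition inbandP {B : nat} (ql qh : 'I_B -> X -> R) (t : nat) (z : X * R)
  : bool :=
  (order_stat [seq ql b z.1 | b <- enum 'I_B] (B.+1 - t) <= z.2%:E)%E &&
  (z.2%:E <= order_stat [seq qh b z.1 | b <- enum 'I_B] t)%E.

(* Y_{n+1} in C_n(X_{n+1}) for UACQR-P; T = {0,..,B+1}, hat t = min of the
   feasible set (value B+2 encodes "empty", in which case C_n = R). *)
Definition coveredP (alpha : R) (n0 : nat) {n B : nat} (ql qh : 'I_B -> X -> R)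
  (d : n.+1.-tuple (X * R)) : Prop :=
  let feas (t : nat) : bool := (1 - alpha) * ((n - n0).+1)%:R
                  <= (calib_count n0 (inbandP ql qh t) d)%:R in
  let that := (\big[minn/B.+2]_(t < B.+2 | feas t) t)%N in
  that = B.+2 \/ inbandP ql qh that (tnth d ord_max).

End conformal_defs.

(* Main.v *)
Require Import Defs.
From HB Require Import structures.
From mathcomp Require Import all_boot all_order all_algebra all_fingroup.
From mathcomp Require Import all_classical all_reals all_analysis.
From mathcomp Require Import measurable_realfun.
Import Order.TTheory GRing.Theory Num.Theory.
Local Open Scope classical_set_scope.
Local Open Scope ring_scope.

(** Both bands are nested sublevel sets of a conformity score: [z] lies in the
band at level [t] iff [score z <= t].  Hence the test point is covered iff fewer
than [tau = (1 - alpha) (n1 + 1)] calibration scores are strictly below the test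
score.  The score depends on the data only through the training part and the
auxiliary randomness, so exchanging the test point with a calibration point
preserves the law of (data, auxiliary randomness), and each of the [n1 + 1]
non-training points has strict rank below [tau] with the same probability.
Since at least [tau] of them always do, this probability is at least
[tau / (n1 + 1) = 1 - alpha]. *)

(** * Joint law of the data and the auxiliary randomness *)

Lemma measurable_permute_tuple {d} {T : measurableType d} {m : nat} (s : 'S_m) :
  measurable_fun [set: m.-tuple T] (permute_tuple s).
Proof.
apply/measurable_fun_tnthP => i.
rewrite (_ : _ \o _ = fun t : m.-tuple T => tnth t (s i)); last first.
  by apply/funext => t; rewrite /= tnth_mktuple.
exact: measurable_tnth.
Qed.

(** Measurable rectangles are stable under intersection and generate the product sigma-algebra, so
    it suffices to compare the two laws there. On a rectangle, independence factors both laws and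
    exchangeability equates the data factors. *)
Lemma exchangeable_independent_joint {R : realType} {d dT dU : measure_display}
    {Omega : measurableType d} {T : measurableType dT} {U : measurableType dU}
    {m : nat} (P : probability Omega R) (D : Omega -> m.-tuple T)
    (u : Omega -> U) (s : 'S_m) (C : set (m.-tuple T * U)) :
  measurable_fun setT D -> measurable_fun setT u ->
  exchangeable P D -> independent_rv P u D -> measurable C ->
  P ((fun w => (permute_tuple s (D w), u w)) @^-1` C) =
  P ((fun w => (D w, u w)) @^-1` C).
Proof.
move=> mD mu exD indD mC.
have msD : measurable_fun setT (fun w => permute_tuple s (D w)).
  exact: measurableT_comp (measurable_permute_tuple s) mD.
have mf1 : (fun w => (permute_tuple s (D w), u w)) \in
    @mfun _ _ Omega (m.-tuple T * U)%type.
  by apply: mem_set; exact: measurable_fun_pair.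
have mf2 : (fun w => (D w, u w)) \in
    @mfun _ _ Omega (m.-tuple T * U)%type.
  by apply: mem_set; exact: measurable_fun_pair.
have := @measure_unique _ R _
  [set A `*` B | A in @measurable _ (m.-tuple T) & B in @measurable _ U]
  (fun=> setT) (measurable_prod_measurableType _ _) _ _ _
  (distribution P (mfun_Sub mf1)) (distribution P (mfun_Sub mf2)) _ _ C mC.
apply.
- move=> _ _ [A1 mA1 [B1 mB1 <-]] [A2 mA2 [B2 mB2 <-]].
  exists (A1 `&` A2); first exact: measurableI.
  by exists (B1 `&` B2); [exact: measurableI|rewrite setXI].
- by move=> _; exists setT => //; exists setT => //; rewrite setXTT.
- by rewrite bigcup_const.
- move=> _ [A mA [B mB <-]]; rewrite /distribution /pushforward /=.
  transitivity (P (u @^-1` B `&` D @^-1` (permute_tuple s @^-1` A))).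
    by congr (P _); apply/seteqP; split => w [].
  transitivity (P (u @^-1` B `&` D @^-1` A)); last first.
    by congr (P _); apply/seteqP; split => w [].
  rewrite !indD//; last first.
    by rewrite -[X in measurable X]setTI; exact: measurable_permute_tuple.
  by congr (_ * _)%E; exact: exD.
- by move=> _; rewrite (le_lt_trans (probability_le1 _ _)) ?ltry.
Qed.

(** * Measurability of counts *)

Lemma measurable_fun_sumn {d} {T : measurableType d} {I : Type} (r : seq I)
    (Q : pred I) (f : I -> T -> nat) :
  (forall i, measurable_fun setT (f i)) ->
  measurable_fun setT (fun x => \sum_(i <- r | Q i) f i x)%N.
Proof.
move=> mf; elim: r => [|i r IH].
  by under eq_fun do rewrite big_nil; exact: measurable_cst.
under eq_fun do rewrite big_cons; case: (Q i) => //.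
exact: measurable_fun_addn.
Qed.

Lemma measurable_fun_nat_of_bool {d} {T : measurableType d} (b : T -> bool) :
  measurable_fun setT b -> measurable_fun setT (fun x => b x : nat).
Proof. by move=> mb; exact: measurable_fun_ifT. Qed.

(** * Deterministic counting: ranks and feasible thresholds *)

Lemma sum_small_rank_ge {R : realType} {I : finType} (A : pred I) (s : I -> R)
    (tau : R) :
  tau <= #|A|%:R ->
  tau <= (\sum_(j | A j) ((\sum_(i | A i) (s i < s j)%R)%:R < tau)%R)%:R.
Proof.
(* If some index is bad, all indices strictly below a lowest bad one are good,
   and badness says there are at least [tau] of them. *)
move=> tauA.
pose rk j := (\sum_(i | A i) (s i < s j)%R)%N.
have [/forallP/= good|/forallPn/= [j0]] :=
    boolP [forall j, A j ==> ((rk j)%:R < tau)%R].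
  rewrite (le_trans tauA)// ler_nat -sum1_card leq_sum// => j Aj.
  by move/implyP : (good j) => /(_ Aj) ->.
rewrite negb_imply -leNgt => j0P.
case: (@Order.TotalTheory.arg_minP _ _ _ j0
  (fun j => A j && (tau <= (rk j)%:R)) s j0P) => j /andP[Aj tauj] jmin.
rewrite (le_trans tauj)// ler_nat leq_sum// => i Ai.
have [sij|//] := ltP (s i) (s j).
case: ltP => // taui; have := jmin i.
by rewrite Ai taui/= => /(_ isT); rewrite leNgt sij.
Qed.

(** The count of scores at most [t] jumps only at scores, so some [t < m] is feasible exactly when
    the largest score below [m] is, that is, when at least [tau] scores lie below [m]. *)
Lemma le_inf_feasible {R : realType} {I : finType} (A : pred I) (s : I -> R)
    (m tau : R)
    (feas := [set t : R | tau <= (\sum_(i | A i) (s i <= t)%R)%:R]) :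
  0 < tau ->
  (feas = set0 \/ m <= inf feas) <-> (\sum_(i | A i) (s i < m)%R)%:R < tau.
Proof.
move=> tau0; split=> [|rk_lt]; last first.
  have [|/set0P ne0] := eqVneq feas set0; [by left|right].
  apply: lb_le_inf => // t; rewrite /feas /= => ft.
  rewrite leNgt; apply/negP => tm.
  move: rk_lt; rewrite ltNge => /negP; apply; rewrite (le_trans ft)// ler_nat.
  apply: leq_sum => i _; have [sit|//] := leP (s i) t.
  by rewrite (le_lt_trans sit tm).
have witness (Q : pred I) :
    tau <= (\sum_(i | A i) Q i)%:R -> exists i, A i && Q i.
  move=> h; have [/existsP//|/existsPn none] := boolP [exists i, A i && Q i].
  move: (lt_le_trans tau0 h); rewrite big1 ?ltxx// => i Ai.
  by have := none i; rewrite Ai /= => /negbTE ->.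
move=> cov; rewrite ltNge; apply/negP => rk_ge.
have [i0 i0P] := witness _ rk_ge.
(* The largest score below [m] dominates all scores below [m], hence is feasible. *)
case: (@Order.TotalTheory.arg_maxP _ _ _ i0
  (fun i => A i && (s i < m)) s i0P) => i /andP[Ai sim] imax.
have fi : feas (s i).
  rewrite /feas /= (le_trans rk_ge)// ler_nat leq_sum// => j Aj.
  have [sjm|//] := ltP (s j) m.
  by have -> : s j <= s i by apply: imax; rewrite Aj.
case: cov => [f0|]; first by rewrite f0 in fi.
rewrite leNgt => /negP; apply; apply: le_lt_trans sim; apply: ge_inf => //.
(* The least score bounds [feas] from below: as [0 < tau], every feasible [t] has a score at or
   below it. *)
case: (@Order.TotalTheory.arg_minP _ _ _ i A s Ai) => k Ak kmin.
exists (s k) => t ft; have [j /andP[Aj sjt]] := witness _ ft.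
exact: le_trans (kmin j Aj) sjt.
Qed.

(** Discrete analogue: for [m > 0], being below [m] means being at most [m - 1], so [m - 1] is the
    threshold to test. The default [N] of an empty minimum already exceeds [m]. *)
Lemma le_bigmin_feasible {R : realType} {I : finType} (A : pred I)
    (s : I -> nat) (m N : nat) (tau : R)
    (feas := fun t : nat => tau <= (\sum_(i | A i) (s i <= t)%N)%:R) :
  0 < tau -> (m < N)%N ->
  (m <= \big[minn/N]_(t < N | feas t) t)%N <->
  (\sum_(i | A i) (s i < m)%N)%:R < tau.
Proof.
move=> tau0 mN; split=> [|rk_lt].
  rewrite ltNge; case: m mN => [|m] mN mmin; apply/negP => rk_ge.
    (* For [m = 0] nothing lies below [m], and a zero count cannot reach [tau > 0]. *)
    by move: (lt_le_trans tau0 rk_ge); rewrite big1 ?ltxx.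
  move: mmin; rewrite leqNgt ltnS => /negP; apply.
  rewrite -minEnat.
  exact: (@bigmin_le_cond _ nat _ _ (Ordinal (ltnW mN))
    (fun t : 'I_N => feas t) val).
elim/big_ind : _ => //; first exact: ltnW.
  by move=> x y mx my; rewrite leq_min mx.
move=> t ft; rewrite leqNgt; apply/negP => tm.
move: rk_lt; rewrite ltNge => /negP; apply; rewrite (le_trans ft)// ler_nat.
apply: leq_sum => i _; have [sit|//] := leqP (s i) t.
by rewrite (leq_ltn_trans sit tm).
Qed.

(** * Coverage for an abstract score fitted on the training data *)

Section coverage.
Context {R : realType} {d dT dU : measure_display} {Omega : measurableType d}
  {T : measurableType dT} {U : measurableType dU} (P : probability Omega R)
  (n n0 : nat) (D : Omega -> n.+1.-tuple T) (u : Omega -> U)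
  (S : n.+1.-tuple T -> U -> T -> R).

(** The test index is part of the range, which makes the range invariant under swapping it with a
    calibration index. *)
Let rank (j : 'I_n.+1) (t : n.+1.-tuple T) (v : U) : nat :=
  (\sum_(i < n.+1 | (n0 <= i)%N) (S t v (tnth t i) < S t v (tnth t j))%R)%N.

Lemma measurable_rank j :
  measurable_fun setT (fun p : (n.+1.-tuple T * U) * T => S p.1.1 p.1.2 p.2) ->
  measurable_fun setT (fun p : n.+1.-tuple T * U => rank j p.1 p.2).
Proof.
move=> mS; apply: measurable_fun_sumn => i; apply: measurable_fun_nat_of_bool.
have mSi k : measurable_fun setT
    (fun p : n.+1.-tuple T * U => S p.1 p.2 (tnth p.1 k)).
  apply: (measurableT_comp mS (g := fun p => (p, tnth p.1 k))).
  apply: measurable_fun_pair => //.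
  exact: measurableT_comp (measurable_tnth k) measurable_fst.
exact: measurable_fun_ltr.
Qed.

(** The transposition fixes every training index, so the fitted score is unchanged; it permutes the
    non-training indices, so the sum is only reindexed. *)
Lemma rank_permute (j : 'I_n.+1) t v :
  (forall t t' : n.+1.-tuple T,
    (forall i : 'I_n.+1, (i < n0)%N -> tnth t i = tnth t' i) -> S t = S t') ->
  (n0 <= j)%N ->
  rank ord_max (permute_tuple (tperm j ord_max) t) v = rank j t v.
Proof.
move=> trS n0j; set s := tperm _ _.
have n0n : (n0 <= n)%N by rewrite (leq_trans n0j)// -ltnS ltn_ord.
have n0s i : (n0 <= s i)%N = (n0 <= i)%N.
  by rewrite /s; case: tpermP => [->|->|//]; rewrite n0j n0n.
have -> : rank ord_max (permute_tuple s t) v =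
    (\sum_(i < n.+1 | (n0 <= i)%N)
      (S t v (tnth t (s i)) < S t v (tnth t j))%R)%N.
  apply: eq_bigr => i _; rewrite !tnth_mktuple tpermR.
  suff -> : S (permute_tuple s t) = S t by [].
  apply: trS => k k_lt; rewrite tnth_mktuple /s tpermD//.
    by apply: contraTneq k_lt => <-; rewrite -leqNgt.
  by apply: contraTneq k_lt => <-; rewrite -leqNgt.
rewrite /rank [RHS](reindex_inj (@perm_inj _ s))/=.
by apply: eq_bigl => i; rewrite n0s.
Qed.

Lemma rank_coverage (alpha : R) :
  (n0 <= n)%N -> 0 <= alpha <= 1 ->
  measurable_fun setT D -> measurable_fun setT u ->
  exchangeable P D -> independent_rv P u D ->
  measurable_fun setT (fun p : (n.+1.-tuple T * U) * T => S p.1.1 p.1.2 p.2) ->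
  (forall t t' : n.+1.-tuple T,
    (forall i : 'I_n.+1, (i < n0)%N -> tnth t i = tnth t' i) -> S t = S t') ->
  ((1 - alpha)%:E <=
   P [set w | ((rank ord_max (D w) (u w))%:R
                < (1 - alpha) * (n - n0).+1%:R)%R])%E.
Proof.
move=> n0n /andP[alpha0 alpha1] mD mu exD indD mS trS.
set tau := (_ * _).
(* The events live on pairs (data, auxiliary randomness), where the invariance of the joint law
   applies. *)
pose A j := [set p : n.+1.-tuple T * U | (rank j p.1 p.2)%:R < tau].
have mA j : measurable (A j).
  rewrite -[A j]setTI.
  exact: (measurable_rank j mS _ [set k : nat | k%:R < tau]).
have mDu : measurable_fun setT (fun w => (D w, u w)).
  exact: measurable_fun_pair.
pose E j := (fun w => (D w, u w)) @^-1` A j.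
have mE j : measurable (E j) by rewrite -[E j]setTI; exact: mDu.
have eqE (j : 'I_n.+1) : (n0 <= j)%N -> P (E j) = P (E ord_max).
  move=> n0j.
  rewrite -(exchangeable_independent_joint P D u (tperm j ord_max)
    (A ord_max))//.
  by congr (P _); apply/seteqP; split => w; rewrite /E /A /= rank_permute.
have cardA : #|[pred i : 'I_n.+1 | (n0 <= i)%N]| = (n - n0).+1.
  rewrite -sum1_card -subSn// -[RHS]muln1 -sum_nat_const_nat big_geq_mkord.
  exact: eq_bigl.
(* The right side is the expected number of points of rank below [tau]; the pointwise bound
   [sum_small_rank_ge] is integrated. *)
have sumE : (tau%:E <= \sum_(j < n.+1 | (n0 <= j)%N) P (E j))%E.
  have PE j : P (E j) = (\int[P]_w (\1_(E j) w)%:E)%E.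
    by rewrite integral_indic// setIT.
  rewrite (eq_bigr _ (fun j _ => PE j)) -big_filter -ge0_integral_sum//; last first.
    by move=> j; apply/measurable_EFinP; exact: measurable_indic.
  rewrite -[leLHS]mule1 -(@probability_setT _ _ _ P) -integral_cst//.
  apply: ge0_le_integral => //.
  - by move=> w _; rewrite lee_fin mulr_ge0// subr_ge0.
  - apply: emeasurable_sum => j; apply/measurable_EFinP.
    exact: measurable_indic.
  - move=> w _; rewrite big_filter sumEFin lee_fin /=.
    under eq_bigr do rewrite indicE mem_setE.
    rewrite -natr_sum.
    have := @sum_small_rank_ge _ _ [pred i : 'I_n.+1 | (n0 <= i)%N]
      (fun i => S (D w) (u w) (tnth (D w) i)) tau.
    rewrite cardA; apply.
    (* [tau] is at most the number of points because [0 <= alpha]. *)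
    by rewrite ler_piMl// gerBl.
(* All [n - n0 + 1] summands equal [P (E ord_max)]; dividing by their number leaves [1 - alpha]. *)
move: sumE; rewrite (eq_bigr _ eqE).
rewrite -/(E ord_max) -(fineK (fin_num_measure P _ (mE ord_max))).
rewrite sumEFin !lee_fin (sumr_const [pred i : 'I_n.+1 | (n0 <= i)%N]) cardA.
rewrite -mulr_natr.
by rewrite ler_pM2r// ltr0n.
Qed.

End coverage.

(** * From calibration counts to ranks, and the score of UACQR-S *)

(** The test score is not strictly below itself, so the calibration count agrees with the symmetric
    rank. *)
Lemma sum_strict_rank_max {R : realType} {n : nat} (n0 : nat)
    (s : 'I_n.+1 -> R) :
  (\sum_(i < n.+1 | (n0 <= i < n)%N) (s i < s ord_max)%R)%N =
  (\sum_(i < n.+1 | (n0 <= i)%N) (s i < s ord_max)%R)%N.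
Proof.
rewrite [LHS]big_mkcond [RHS]big_mkcond; apply: eq_bigr => i _.
have [->|ni] := eqVneq i ord_max; first by rewrite ltxx !if_same.
by rewrite (_ : (i < n)%N) ?andbT// ltn_neqAle ni -ltnS ltn_ord.
Qed.

(** For positive [gl] and [gh], the least [t] whose band contains [z]: one quotient per endpoint. *)
Definition scoreS {R : realType} {X : Type} (ql qh gl gh : X -> R)
    (z : X * R) : R :=
  Order.max ((ql z.1 - z.2) / gl z.1) ((z.2 - qh z.1) / gh z.1).

Lemma inbandS_score {R : realType} {dX} {X : measurableType dX}
    (ql qh gl gh : X -> R) t z :
  (forall x, 0 < gl x) -> (forall x, 0 < gh x) ->
  inbandS ql qh gl gh t z = (scoreS ql qh gl gh z <= t).
Proof.
move=> gl0 gh0; rewrite /inbandS /scoreS ge_max !ler_pdivrMr//.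
by rewrite lerBlDr !lerBlDl.
Qed.

Lemma coveredS_rank {R : realType} {dX} {X : measurableType dX} (alpha : R)
    (n0 n : nat) (ql qh gl gh : X -> R) (d : n.+1.-tuple (X * R)) :
  alpha < 1 -> (forall x, 0 < gl x) -> (forall x, 0 < gh x) ->
  coveredS alpha n0 ql qh gl gh d <->
  (\sum_(i < n.+1 | (n0 <= i)%N) (scoreS ql qh gl gh (tnth d i)
      < scoreS ql qh gl gh (tnth d ord_max))%R)%:R
  < (1 - alpha) * (n - n0).+1%:R.
Proof.
move=> alpha1 gl0 gh0.
have tau0 : 0 < (1 - alpha) * (n - n0).+1%:R.
  by rewrite mulr_gt0 ?ltr0n// subr_gt0.
rewrite -(sum_strict_rank_max n0 (fun i => scoreS ql qh gl gh (tnth d i))).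
rewrite -(le_inf_feasible _ _ _ _ tau0) /coveredS /calib_count/=.
rewrite inbandS_score//.
have -> // : [set t | (1 - alpha) * (n - n0).+1%:R <=
    (\sum_(i < n.+1 | (n0 <= i < n)%N) inbandS ql qh gl gh t (tnth d i))%:R] =
  [set t : R | (1 - alpha) * (n - n0).+1%:R <=
    (\sum_(i < n.+1 | (n0 <= i < n)%N) (scoreS ql qh gl gh (tnth d i) <= t)%R)%:R].
by apply/funext => t /=; under eq_bigr do rewrite inbandS_score//.
Qed.

(** * Order statistics and the score of UACQR-P *)

(** In the sorted list the entries at most [y] form an initial segment. The infinite conventions
    agree with this, since a count lies between [0] and [size s]. *)
Lemma order_stat_le {R : realType} (s : seq R) k (y : R) :
  (order_stat s k <= y%:E)%E = (k <= count (<= y) s)%N.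
Proof.
rewrite /order_stat; case: k => [|k]/=; first by rewrite leNye.
have srt : sorted <=%R (sort <=%R s) by exact: sort_le_sorted.
case: (ltnP k (size s)) => ks; last first.
  by rewrite leye_eq/= ltnNge (leq_trans (count_size _ _)).
rewrite lee_fin -(count_sort <=%R); apply/idP/idP => [|h]; last exact: nth_count_le.
apply: contraTT; rewrite -leqNgt -ltNge => h.
by apply: nth_count_gt => //; rewrite h size_sort.
Qed.

Lemma order_stat_ge {R : realType} (s : seq R) k (y : R) :
  (y%:E <= order_stat s k)%E = (count (< y) s < k)%N.
Proof.
rewrite /order_stat; case: k => [|k]/=; first by rewrite leeNy_eq.
have srt : sorted <=%R (sort <=%R s) by exact: sort_le_sorted.
case: (ltnP k (size s)) => ks; last first.
  by rewrite leey ltnS (leq_trans (count_size _ _)).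
rewrite lee_fin ltnS -(count_sort <=%R); apply/idP/idP => [|h]; last first.
  by apply: nth_count_ge => //; rewrite h size_sort.
by apply: contraTT; rewrite -ltnNge -ltNge => h; exact: nth_count_lt.
Qed.

(** The least [t] whose band contains [z]: the first term solves the lower-endpoint condition for
    [t], the second the upper one, where a strict inequality gives the successor. *)
Definition scoreP {R : realType} {X : Type} {B : nat} (ql qh : 'I_B -> X -> R)
    (z : X * R) : nat :=
  maxn (B.+1 - count (fun b => ql b z.1 <= z.2) (enum 'I_B))
       (count (fun b => qh b z.1 < z.2) (enum 'I_B)).+1.

Lemma inbandP_score {R : realType} {dX} {X : measurableType dX} {B : nat}
    (ql qh : 'I_B -> X -> R) t z :
  inbandP ql qh t z = (scoreP ql qh z <= t)%N.
Proof.
rewrite /inbandP /scoreP order_stat_le order_stat_ge !count_map geq_max.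
by rewrite !leq_subLR addnC.
Qed.

(** At [t = B + 1] the band is the whole line, so no score reaches the value [B.+2] that encodes an
    empty feasible set. *)
Lemma scoreP_lt {R : realType} {X : Type} {B : nat} (ql qh : 'I_B -> X -> R) z :
  (scoreP ql qh z < B.+2)%N.
Proof.
rewrite /scoreP ltnS geq_max leq_subr ltnS.
by rewrite -[leqRHS](size_enum_ord B) count_size.
Qed.

Lemma coveredP_rank {R : realType} {dX} {X : measurableType dX} (alpha : R)
    (n0 n B : nat) (ql qh : 'I_B -> X -> R) (d : n.+1.-tuple (X * R)) :
  alpha < 1 ->
  coveredP alpha n0 ql qh d <->
  (\sum_(i < n.+1 | (n0 <= i)%N) ((scoreP ql qh (tnth d i))%:R
      < (scoreP ql qh (tnth d ord_max))%:R :> R)%R)%:R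
  < (1 - alpha) * (n - n0).+1%:R.
Proof.
move=> alpha1.
have tau0 : 0 < (1 - alpha) * (n - n0).+1%:R.
  by rewrite mulr_gt0 ?ltr0n// subr_gt0.
rewrite -(sum_strict_rank_max n0 (fun i => (scoreP ql qh (tnth d i))%:R)).
under eq_bigr do rewrite ltr_nat.
rewrite -(le_bigmin_feasible _ _ _ _ _ tau0 (scoreP_lt ql qh _)).
rewrite /coveredP inbandP_score /calib_count.
set that1 := \big[_/_]_(_ < _ | _) _.
set that2 := \big[_/_]_(_ < _ | _) _.
have -> : that1 = that2.
  apply: eq_bigl => t.
  by congr (_ <= _%:R); apply: eq_bigr => i _; rewrite inbandP_score.
(* In the empty case the threshold is [B.+2], which exceeds every score, so that disjunct is
   absorbed. *)
split; [|by right].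
by case=> // ->; rewrite ltnW// scoreP_lt.
Qed.

(** * Joint measurability of the scores *)

Lemma measurable_scoreS {R : realType} {d dX} {Z : measurableType d}
    {X : measurableType dX} (ql qh gl gh : Z -> X -> R) :
  (forall t x, 0 < gl t x) -> (forall t x, 0 < gh t x) ->
  measurable_fun setT (fun p : Z * X => ql p.1 p.2) ->
  measurable_fun setT (fun p : Z * X => qh p.1 p.2) ->
  measurable_fun setT (fun p : Z * X => gl p.1 p.2) ->
  measurable_fun setT (fun p : Z * X => gh p.1 p.2) ->
  measurable_fun setT (fun p : Z * (X * R) =>
    scoreS (ql p.1) (qh p.1) (gl p.1) (gh p.1) p.2).
Proof.
move=> gl0 gh0 mql mqh mgl mgh.
have mpr : measurable_fun setT (fun p : Z * (X * R) => (p.1, p.2.1)).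
  apply: measurable_fun_pair => //.
  exact: measurableT_comp measurable_fst measurable_snd.
have my : measurable_fun setT (fun p : Z * (X * R) => p.2.2).
  exact: measurableT_comp measurable_snd measurable_snd.
(* For positive [g], the inverse is [expR (- ln g)], a composition of measurable maps. *)
have mV (g : Z -> X -> R) : (forall t x, 0 < g t x) ->
    measurable_fun setT (fun p : Z * X => g p.1 p.2) ->
    measurable_fun setT (fun p : Z * (X * R) => (g p.1 p.2.1)^-1).
  move=> g0 mg.
  rewrite (_ : (fun p => _) =
      fun p : Z * (X * R) => expR (- ln (g p.1 p.2.1))).
    apply: measurableT_comp => //; apply: measurable_funN.
    by apply: measurableT_comp => //; exact: measurableT_comp mg mpr.
  by apply/funext => p; rewrite expRN lnK// posrE.
apply: measurable_maxr; apply: measurable_funM; try exact: mV.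
  by apply: measurable_funB => //; exact: measurableT_comp mql mpr.
by apply: measurable_funB => //; exact: measurableT_comp mqh mpr.
Qed.

Lemma measurable_scoreP {R : realType} {d dX} {Z : measurableType d}
    {X : measurableType dX} {B : nat} (ql qh : 'I_B -> Z -> X -> R) :
  (forall b, measurable_fun setT (fun p : Z * X => ql b p.1 p.2)) ->
  (forall b, measurable_fun setT (fun p : Z * X => qh b p.1 p.2)) ->
  measurable_fun setT (fun p : Z * (X * R) =>
    (scoreP (fun b => ql b p.1) (fun b => qh b p.1) p.2)%:R : R).
Proof.
move=> mql mqh.
have mpr : measurable_fun setT (fun p : Z * (X * R) => (p.1, p.2.1)).
  apply: measurable_fun_pair => //.
  exact: measurableT_comp measurable_fst measurable_snd.
have my : measurable_fun setT (fun p : Z * (X * R) => p.2.2).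
  exact: measurableT_comp measurable_snd measurable_snd.
have mcount (b : 'I_B -> Z * (X * R) -> bool) :
    (forall i, measurable_fun setT (b i)) ->
    measurable_fun setT (fun p => count (b^~ p) (enum 'I_B)).
  move=> mb; under eq_fun do rewrite -sum1_count big_mkcond.
  apply: measurable_fun_sumn => i; exact: measurable_fun_nat_of_bool.
(* Maps out of the discrete space [nat] are measurable, so the cast to [R] can be removed. *)
suff mscore : measurable_fun setT (fun p : Z * (X * R) =>
    scoreP (fun b => ql b p.1) (fun b => qh b p.1) p.2).
  by apply: (measurableT_comp (f := fun k : nat => k%:R : R)) mscore.
apply: measurable_fun_maxn.
  apply: (measurableT_comp (f := fun k : nat => (B.+1 - k)%N)) => //.
  apply: mcount => b; apply: measurable_fun_ler => //.
  exact: measurableT_comp (mql b) mpr.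
apply: (measurableT_comp (f := S)) => //.
apply: mcount => b; apply: measurable_fun_ltr => //.
exact: measurableT_comp (mqh b) mpr.
Qed.

(** * Coverage of both methods *)

Theorem theorem1 (R : realType)
  (dX : measure_display) (X : measurableType dX)
  (dU : measure_display) (U : measurableType dU)
  (d : measure_display) (Omega : measurableType d) (P : probability Omega R)
  (alpha : R) (n n0 : nat)
  (D : Omega -> n.+1.-tuple (X * R)) (u : Omega -> U) :
  0 < alpha < 1 ->
  (n0 < n)%N ->
  measurable_fun [set: Omega] D ->
  measurable_fun [set: Omega] u ->
  exchangeable P D ->
  independent_rv P u D ->
  (* UACQR-S *)
  (forall ql qh gl gh : n.+1.-tuple (X * R) -> U -> X -> R,
      fitted_on_training n0 ql -> fitted_on_training n0 qh ->
      fitted_on_training n0 gl -> fitted_on_training n0 gh ->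
      (forall t v x, 0 < gl t v x) -> (forall t v x, 0 < gh t v x) ->
      ((1 - alpha)%:E <=
         P [set w | coveredS alpha n0 (ql (D w) (u w)) (qh (D w) (u w))
                      (gl (D w) (u w)) (gh (D w) (u w)) (D w)])%E)
  /\
  (* UACQR-P *)
  (forall (B : nat) (ql qh : 'I_B -> n.+1.-tuple (X * R) -> U -> X -> R),
      (forall b, fitted_on_training n0 (ql b)) ->
      (forall b, fitted_on_training n0 (qh b)) ->
      ((1 - alpha)%:E <=
         P [set w | coveredP alpha n0 (fun b => ql b (D w) (u w))
                      (fun b => qh b (D w) (u w)) (D w)])%E).
Proof.
move=> /andP[alpha0 alpha1] n0n mD mu exD indD.
have alpha01 : 0 <= alpha <= 1 by rewrite !ltW.
split=> [ql qh gl gh [trql mql] [trqh mqh] [trgl mgl] [trgh mgh] gl0 gh0|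
         B ql qh fql fqh].
(* Once coverage is rewritten as a rank event, the score must be shown measurable and dependent on
   the data only through the training part. *)
- have := @rank_coverage R _ _ _ _ _ _ P n n0 D u
    (fun t v => scoreS (ql t v) (qh t v) (gl t v) (gh t v))
    alpha (ltnW n0n) alpha01 mD mu exD indD.
  rewrite (_ : [set w | coveredS _ _ _ _ _ _ _] =
    [set w | (\sum_(i < n.+1 | (n0 <= i)%N) (
      scoreS (ql (D w) (u w)) (qh (D w) (u w)) (gl (D w) (u w)) (gh (D w) (u w))
        (tnth (D w) i) <
      scoreS (ql (D w) (u w)) (qh (D w) (u w)) (gl (D w) (u w)) (gh (D w) (u w))
        (tnth (D w) ord_max))%R)%:R < (1 - alpha) * (n - n0).+1%:R]); last first.
    by apply/seteqP; split => w /=; rewrite coveredS_rank.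
  apply.
    apply: (@measurable_scoreS _ _ _ (n.+1.-tuple (X * R) * U)%type _
      (fun p => ql p.1 p.2) (fun p => qh p.1 p.2) (fun p => gl p.1 p.2)
      (fun p => gh p.1 p.2)) => //.
  move=> t t' tt'.
  by rewrite (trql _ _ tt') (trqh _ _ tt') (trgl _ _ tt') (trgh _ _ tt').
(* The integer score is cast to [R], which preserves strict comparisons and hence ranks. *)
- have := @rank_coverage R _ _ _ _ _ _ P n n0 D u
    (fun t v z => (scoreP (fun b => ql b t v) (fun b => qh b t v) z)%:R)
    alpha (ltnW n0n) alpha01 mD mu exD indD.
  rewrite (_ : [set w | coveredP _ _ _ _ _] =
    [set w | (\sum_(i < n.+1 | (n0 <= i)%N) (
      (scoreP (fun b => ql b (D w) (u w)) (fun b => qh b (D w) (u w))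
        (tnth (D w) i))%:R <
      (scoreP (fun b => ql b (D w) (u w)) (fun b => qh b (D w) (u w))
        (tnth (D w) ord_max))%:R :> R)%R)%:R < (1 - alpha) * (n - n0).+1%:R]);
    last first.
    by apply/seteqP; split => w /=; rewrite coveredP_rank.
  apply.
    apply: (@measurable_scoreP _ _ _ (n.+1.-tuple (X * R) * U)%type _ _
      (fun b p => ql b p.1 p.2) (fun b p => qh b p.1 p.2)) => b.
      exact: (fql b).2.
    exact: (fqh b).2.
  move=> t t' tt'; apply/funext => v; apply/funext => z.
  have -> : (fun b => ql b t v) = (fun b => ql b t' v).
    by apply/funext => b; rewrite ((fql b).1 _ _ tt').
  by have -> : (fun b => qh b t v) = (fun b => qh b t' v)
    by apply/funext => b; rewrite ((fqh b).1 _ _ tt').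
Qed.
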